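(* Let $B_2^1=\{0,E,E_{12},E_{21},E_{11},E_{22}\}$ be the 6-element Brandt monoid of zero-one $2\times 2$-matrices under matrix multiplication $\cdot$, and let $\oplus$ be the binary operation on $B_2^1$ given by $x\oplus y:=(xy^{-1})^2x$, where $x^{-1}$ denotes the transpose of $x$. Then the semiring identities of the additively idempotent semiring $(B_2^1,\oplus,\cdot)$ admit no basis involving only finitely many variables, and hence no finite basis.
   Context: The monoid $B_2^1$ consists of the following $2\times 2$ matrices: the zero matrix $0$, the identity matrix $E$, and the four matrix units $E_{12},E_{21},E_{11},E_{22}$ ($E_{ij}$ has entry $1$ in position $(i,j)$ and $0$'s elsewhere); the operation $\cdot$ is the usual matrix multiplication. The map $x\mapsto x^{-1}$ is matrix transposition: it swaps $E_{12}$ and $E_{21}$ and fixes all other elements. It sends each $x$ to its unique inverse in the semigroup sense, i.e. the unique $y$ with $xyx=x$ and $yxy=y$. An additively idempotent semiring is an algebra $(S,+,\cdot)$ of type $(2,2)$ such that $(S,+)$ is a semilattice (a commutative idempotent semigroup), $(S,\cdot)$ is a semigroup, and multiplication distributes over addition on the left and on the right. The algebra $(B_2^1,\oplus,\cdot)$ is an additively idempotent semiring with addition $\oplus$. A semiring identity is a formal equality $u\approx v$ of two terms in the signature $\{+,\cdot\}$ (two binary operation symbols, no constants) over a countably infinite set of variables. It holds in an algebra of type $(2,2)$ if $u$ and $v$ take the same value under every evaluation of the variables in that algebra. In $(B_2^1,\oplus,\cdot)$ the symbol $+$ is interpreted as $\oplus$. A basis for the semiring identities of $(B_2^1,\oplus,\cdot)$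 is a set $\Sigma$ of semiring identities that hold in $(B_2^1,\oplus,\cdot)$ such that every semiring identity holding in $(B_2^1,\oplus,\cdot)$ is a consequence of $\Sigma$, i.e. holds in every algebra of type $(2,2)$ in which all identities of $\Sigma$ hold. A basis involves only finitely many variables if the set of all variables occurring in its identities is finite. *)

(* Defs.v *)
From mathcomp Require Import all_boot all_algebra.
From mathcomp Require Import classical_sets cardinality.
Set Implicit Arguments.
Unset Strict Implicit.
Unset Printing Implicit Defensive.
Import GRing.Theory.
Local Open Scope ring_scope.
Local Open Scope classical_set_scope.

Record algebra22 := Algebra22 {
  carrier :> Type;
  aadd : carrier -> carrier -> carrier;
  amul : carrier -> carrier -> carrier }.

Inductive term :=
  | Var of nat
  | Add of term & term
  | Mul of term & term.

Fixpoint eval (A : algebra22) (v : nat -> A) (t : term) : A :=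
  match t with
  | Var n => v n
  | Add t1 t2 => aadd (eval v t1) (eval v t2)
  | Mul t1 t2 => amul (eval v t1) (eval v t2)
  end.

Fixpoint term_vars (t : term) : set nat :=
  match t with
  | Var n => [set n]
  | Add t1 t2 | Mul t1 t2 => term_vars t1 `|` term_vars t2
  end.

(* The pair (u, w) stands for the formal identity u ~ w. *)
Definition identity : Type := (term * term)%type.

Definition holds (A : algebra22) (e : identity) : Prop :=
  forall v : nat -> A, eval v e.1 = eval v e.2.

Definition consequence (Sigma : set identity) (e : identity) : Prop :=
  forall A : algebra22, (forall s, Sigma s -> holds A s) -> holds A e.

Definition is_basis (A : algebra22) (Sigma : set identity) : Prop :=
  (forall s, Sigma s -> holds A s) /\
  (forall e, holds A e -> consequence Sigma e).

Definition identities_vars (Sigma : set identity) : set nat :=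
  \bigcup_(e in Sigma) (term_vars e.1 `|` term_vars e.2).

Record ai_semiring := AISemiring {
  ai_algebra :> algebra22;
  ai_addA : associative (@aadd ai_algebra);
  ai_addC : commutative (@aadd ai_algebra);
  ai_addxx : idempotent_op (@aadd ai_algebra);
  ai_mulA : associative (@amul ai_algebra);
  ai_mulDl : left_distributive (@amul ai_algebra) (@aadd ai_algebra);
  ai_mulDr : right_distributive (@amul ai_algebra) (@aadd ai_algebra) }.

(* 0, E, E_12, E_21, E_11, E_22: the indices 1, 2 are the ordinals 0, 1. *)
Definition brandt_elts : seq 'M[int]_2 :=
  [:: 0; 1%:M; delta_mx 0 1; delta_mx 1 0; delta_mx 0 0; delta_mx 1 1].

Definition B21 : Type := {A : 'M[int]_2 | A \in brandt_elts}.

Variant brandt_spec : 'M[int]_2 -> Prop :=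
  | Brandt0 : brandt_spec 0
  | Brandt1 : brandt_spec 1%:M
  | BrandtE i j : brandt_spec (delta_mx i j).

Lemma brandtP (A : 'M[int]_2) : reflect (brandt_spec A) (A \in brandt_elts).
Proof.
apply: (iffP idP); last first.
  case=> [||i j]; rewrite !inE ?eqxx ?orbT //.
  case: i j => [[|[|//]] hi] [[|[|//]] hj];
    (set a := Ordinal hi; set b := Ordinal hj;
     first [have -> : a = 0 by exact: val_inj | have -> : a = 1 by exact: val_inj];
     first [have -> : b = 0 by exact: val_inj | have -> : b = 1 by exact: val_inj]);
    by rewrite eqxx ?orbT.
by rewrite !inE => /orP[/eqP->|/orP[/eqP->|/orP[/eqP->|/orP[/eqP->|/orP[]/eqP->]]]];
  constructor.
Qed.

Lemma brandt_mulmx (A B : 'M[int]_2) :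
  A \in brandt_elts -> B \in brandt_elts -> A *m B \in brandt_elts.
Proof.
move=> /brandtP[||i j] /brandtP[||k l]; apply/brandtP;
  rewrite ?(mul0mx, mulmx0, mul1mx, mulmx1); try by constructor.
by rewrite mul_delta_mx_cond; case: (j == k); constructor.
Qed.

Lemma brandt_trmx (A : 'M[int]_2) : A \in brandt_elts -> A^T \in brandt_elts.
Proof.
by move=> /brandtP[||i j]; apply/brandtP; rewrite ?(trmx0, trmx1, trmx_delta);
  constructor.
Qed.

Definition bmul (x y : B21) : B21 :=
  exist _ (val x *m val y) (brandt_mulmx (valP x) (valP y)).

Definition binv (x : B21) : B21 := exist _ (val x)^T (brandt_trmx (valP x)).

(* (x y^-1)^2 x *)
Definition badd (x y : B21) : B21 :=
  bmul (bmul (bmul x (binv y)) (bmul x (binv y))) x.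

Lemma bmulA : associative bmul.
Proof. by move=> x y z; apply: val_inj; rewrite /= mulmxA. Qed.

(* (+) is the entrywise product, i.e. the intersection of partial injections. *)
Lemma badd_entry (x y : B21) i j :
  val (badd x y) i j = val x i j * val y i j.
Proof.
case: x y => [x xP] [y yP] /=.
case: i j => [[|[|//]] hi] [[|[|//]] hj];
 move: xP yP => /brandtP[||[[|[|//]] ha] [[|[|//]] hb]]
                /brandtP[||[[|[|//]] hc] [[|[|//]] hd]];
 by rewrite ?(trmx0, trmx1, trmx_delta)
            ?(mul0mx, mulmx0, mul1mx, mulmx1, mul_delta_mx_cond) /=
            ?(mulr0n, mulr1n, mul0mx, mulmx0, mul1mx, mulmx1, mul_delta_mx_cond)
            /= ?(mulr0n, mulr1n, mul0mx, mulmx0, mul1mx, mulmx1,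
                 mul_delta_mx_cond) /= !mxE /=.
Qed.

Lemma B21_eqP (x y : B21) : (forall i j, val x i j = val y i j) -> x = y.
Proof. by move=> e; apply: val_inj; apply/matrixP. Qed.

Lemma baddA : associative badd.
Proof. by move=> x y z; apply: B21_eqP => i j; rewrite !badd_entry mulrA. Qed.

Lemma baddC : commutative badd.
Proof. by move=> x y; apply: B21_eqP => i j; rewrite !badd_entry mulrC. Qed.

Lemma baddxx : idempotent_op badd.
Proof.
move=> x; apply: B21_eqP => i j; rewrite badd_entry.
case: x => x /= /brandtP[||a b]; rewrite !mxE ?mulr0 //.
  by case: (i == j); rewrite ?mulr1 ?mulr0.
by case: (_ && _); rewrite ?mulr1 ?mulr0.
Qed.

Lemma bmulDr : right_distributive bmul badd.
Proof.
move=> x y z; apply: B21_eqP => i j; rewrite badd_entry.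
case: x => x xP /=.
rewrite [LHS]mxE [X in X * _]mxE [X in _ * X]mxE.
rewrite (eq_bigr (fun k => x i k * (val y k j * val z k j))); last first.
  by move=> k _; rewrite -badd_entry.
case: i xP => [[|[|//]] hi] /brandtP[||[[|[|//]] ha] [[|[|//]] hb]];
  by rewrite !big_ord_recl !big_ord0 !mxE /=
    ?(mul0r, mul1r, mulr0, addr0, add0r, mulr0n, mulr1n).
Qed.

Lemma bmulDl : left_distributive bmul badd.
Proof.
have invM x y : binv (bmul x y) = bmul (binv y) (binv x).
  by apply: val_inj; rewrite /= trmx_mul.
have binvE x i j : val (binv x) i j = val x j i by rewrite mxE.
have invD x y : binv (badd x y) = badd (binv x) (binv y).
  by apply: B21_eqP => i j; rewrite badd_entry !binvE badd_entry.
have invK : involutive binv by move=> x; apply: val_inj; rewrite /= trmxK.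
move=> x y z; apply: (can_inj invK).
by rewrite invM !invD bmulDr !invM.
Qed.

Definition B21_semiring : ai_semiring :=
  @AISemiring (Algebra22 badd bmul) baddA baddC baddxx bmulA bmulDl bmulDr.

(* Main.v *)
(* An element of B_2^1 is a partial injection of {1,2} contained in E or in a
   matrix unit.  Take the n x n torus grid, with one row cut open, and let the
   letter (i, j) act as the partial injection of the grid edges that moves one
   step to the right across the cell (i, j) along row i, and one step down
   across it along column j.  These letters, together with the partial maps of
   rank at most one, form an algebra under composition and intersection.

   A 2-colouring of the points turns letters into elements of B_2^1 whenever
   each letter either preserves colours, or has its two sources of one colour
   and its two targets of one colour.  Fewer than n variables involve fewer
   than n letters, so every line misses one of them and can be cut there; then
   colouring a single line, or a corner made of two half-lines meeting in a
   cell, gives enough colourings to transfer to the grid every identity of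
   B_2^1 in these variables.  But if all letters are used, a parity count over
   the whole grid forces the two ends of the open row to get the same colour,
   and this is expressed by an identity of B_2^1 that fails in the grid. *)
Require Import Defs.
From mathcomp Require Import all_boot all_algebra.
From mathcomp Require Import zify boolp classical_sets cardinality.

Set Implicit Arguments.
Unset Strict Implicit.
Unset Printing Implicit Defensive.

Import GRing.Theory.

(** * Elements of $B_2^1$ as partial injections of [bool] *)

Definition idx (a : bool) : 'I_2 := if a then ord_max else ord0.

Definition ent (x : B21) (a b : bool) : bool :=
  (val x (idx a) (idx b) != 0)%R.

Lemma idx_surj (i : 'I_2) : exists a, i = idx a.
Proof.
by case: i => [[|[|//]] hi]; [exists false | exists true]; apply: val_inj.
Qed.

Lemma idx_inj : injective idx.
Proof. by case; case. Qed.

Lemma B21_entry (x : B21) i j : val x i j = (val x i j != 0)%R%:R%R.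
Proof.
case: x => x /= /brandtP[||k l]; rewrite !mxE ?eqxx //.
  by case: (i == j).
by case: (_ && _).
Qed.

Lemma ent_inj (x y : B21) : (forall a b, ent x a b = ent y a b) -> x = y.
Proof.
move=> e; apply: B21_eqP => i j.
have [a ->] := idx_surj i; have [b ->] := idx_surj j.
by rewrite B21_entry [RHS]B21_entry -/(ent _ _ _) e.
Qed.

Lemma ent_add (x y : B21) a b : ent (badd x y) a b = ent x a b && ent y a b.
Proof. by rewrite /ent badd_entry mulf_eq0 negb_or. Qed.

Lemma ent_mul (x y : B21) a c :
  ent (bmul x y) a c <-> exists b, ent x a b /\ ent y b c.
Proof.
have -> : ent (bmul x y) a c =
    (ent x a false && ent y false c) || (ent x a true && ent y true c).
  rewrite /ent /= mxE !big_ord_recl big_ord0 addr0.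
  have -> : lift ord0 ord0 = idx true by apply: val_inj.
  rewrite -[ord0]/(idx false).
  move: (B21_entry x (idx a) (idx false)) (B21_entry x (idx a) (idx true)).
  move: (B21_entry y (idx false) (idx c)) (B21_entry y (idx true) (idx c)).
  by do 4 case: (_ != 0)%R => ->.
split=> [/orP[] /andP[]|[[] [-> ->]]]; rewrite ?orbT //.
  by exists false.
by exists true.
Qed.

(* Every element of B_2^1 is contained in E or in a single matrix unit. *)
Lemma ent2 (x : B21) a b a' b' : ent x a b -> ent x a' b' ->
  (a = b /\ a' = b') \/ (a = a' /\ b = b').
Proof.
rewrite /ent; case: x => x /= /brandtP[||k l]; rewrite !mxE ?eqxx //.
  rewrite !(inj_eq idx_inj).
  by case: (a =P b) => // ->; case: (a' =P b') => // ->; left.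
case: (idx a =P k) => // <-; case: (idx b =P l) => //= <-.
rewrite !(inj_eq idx_inj).
by case: (a' =P a) => // ->; case: (b' =P b) => // ->; right.
Qed.

Lemma ent_fun (x : B21) a b b' : ent x a b -> ent x a b' -> b = b'.
Proof. by move=> h /(ent2 h)[[<- <-]|[_ ->]]. Qed.

Lemma ent_cofun (x : B21) a a' b : ent x a b -> ent x a' b -> a = a'.
Proof. by move=> h /(ent2 h)[[-> ->]|[->]]. Qed.

(** Inside [E] both sums are [false], and a matrix unit has a single entry. *)
Lemma ent_parity (x : B21) a b a' b' : ent x a b -> ent x a' b' ->
  a (+) b = a' (+) b'.
Proof. by move=> h /(ent2 h)[[-> ->]|[-> ->]]; rewrite ?addbb. Qed.

Definition bid : B21 := exist _ 1%:M%R (introT (brandtP _) Brandt1).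

Definition bunit (a b : bool) : B21 :=
  exist _ (delta_mx (idx a) (idx b))%R
    (introT (brandtP _) (BrandtE (idx a) (idx b))).

Definition bzero : B21 := exist _ 0%R (introT (brandtP _) Brandt0).

Lemma ent_id a b : ent bid a b = (a == b).
Proof. by rewrite /ent /= mxE (inj_eq idx_inj); case: (a == b). Qed.

Lemma ent_unit a b a' b' : ent (bunit a b) a' b' = (a' == a) && (b' == b).
Proof.
by rewrite /ent /= mxE !(inj_eq idx_inj); case: (_ && _).
Qed.

Lemma ent_zero a b : ent bzero a b = false.
Proof. by rewrite /ent /= mxE eqxx. Qed.

(** * Grid letters and the algebra they generate *)

(* A point (b, l, p) has position p on the row (b = false) or column (b = true)
   number l. *)
Definition pt : Type := (bool * nat * nat)%type.

Definition coord (g : nat * nat) (b : bool) : nat := if b then g.2 else g.1.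

Definition cell (b : bool) (l p : nat) : nat * nat :=
  if b then (p, l) else (l, p).

Lemma coord_cell b l p : coord (cell b l p) b = l.
Proof. by case: b. Qed.

Lemma coord_cellN b l p : coord (cell b l p) (~~ b) = p.
Proof. by case: b. Qed.

Lemma coord_inj g g' b :
  coord g b = coord g' b -> coord g (~~ b) = coord g' (~~ b) -> g = g'.
Proof. by case: g g' b => [i j] [i' j'] [] /= -> ->. Qed.

Lemma cellK g b : cell b (coord g b) (coord g (~~ b)) = g.
Proof. by case: g b => i j []. Qed.

(* All lines are closed up to cycles of length n, except row 0. *)
Definition wrap (n : nat) (b : bool) (l p : nat) : nat :=
  if (p == n) && ((b, l) != (false, 0)) then 0 else p.

Definition src (g : nat * nat) (b : bool) : pt := (b, coord g b, coord g (~~ b)).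

Definition tgt (n : nat) (g : nat * nat) (b : bool) : pt :=
  (b, coord g b, wrap n b (coord g b) (coord g (~~ b)).+1).

Definition letter (n : nat) (g : nat * nat) (x y : pt) : Prop :=
  exists b, x = src g b /\ y = tgt n g b.

Lemma src_inj g g' b b' : src g b = src g' b' -> g = g' /\ b = b'.
Proof. by case=> <- e1 e2; split=> //; apply: coord_inj e1 e2. Qed.

Lemma letter_inj n : injective (letter n).
Proof.
move=> g g' e.
have : letter n g (src g true) (tgt n g true) by exists true.
by rewrite e => -[b [/src_inj[]]].
Qed.

Definition thin (R : pt -> pt -> Prop) : Prop :=
  forall x y x' y', R x y -> R x' y' -> x = x' /\ y = y'.

Definition good (n : nat) (R : pt -> pt -> Prop) : Prop :=
  (exists g, R = letter n g) \/ thin R.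

Definition rcomp (R R' : pt -> pt -> Prop) (x y : pt) : Prop :=
  exists z, R x z /\ R' z y.

Definition rmeet (R R' : pt -> pt -> Prop) (x y : pt) : Prop :=
  R x y /\ R' x y.

Lemma good_fun n R x y y' : good n R -> R x y -> R x y' -> y = y'.
Proof.
case=> [[g ->] [b [-> ->]] [b' [/src_inj[_ <-] ->]] //|thinR h h'].
by have [] := thinR _ _ _ _ h h'.
Qed.

Lemma good_cofun n R x x' y : good n R -> R x y -> R x' y -> x = x'.
Proof.
case=> [[g ->] [b [-> ->]] [b' [-> [<-]]] //|thinR h h'].
by have [] := thinR _ _ _ _ h h'.
Qed.

Lemma good_meet n R R' : good n R -> good n R' -> good n (rmeet R R').
Proof.
move=> [[g ->]|thinR] [[g' ->]|thinR']; last first.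
- by right=> x y x' y' [h _] [h' _]; apply: thinR.
- by right=> x y x' y' [h _] [h' _]; apply: thinR.
- by right=> x y x' y' [_ h] [_ h']; apply: thinR'.
have [<-|neq_g] := eqVneq g g'.
  by left; exists g; apply/funext => x; apply/funext => y; apply/propext; split=> [[]|].
right=> x y x' y' [[b [-> _]] [b' [/src_inj[e]]]].
by rewrite e eqxx in neq_g.
Qed.

(** Two letters compose to rank at most one: if row and column both continued from [g] through [g'],
    a step would fix its point, which only a cycle of length one allows. Hence the side length
    [n.+2]. *)
Lemma good_comp n R R' : good n.+2 R -> good n.+2 R' -> good n.+2 (rcomp R R').
Proof.
move=> gR gR'; case: (gR) (gR') => [[g ->]|thinR] [[g' ->]|thinR']; right; last first.
- move=> x y x' y' [z [h1 h2]] [z' [h1' h2']].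
  have [-> ezz'] := thinR _ _ _ _ h1 h1'; split=> //.
  by move: h2'; rewrite -ezz' => /(good_fun gR' h2).
- move=> x y x' y' [z [h1 h2]] [z' [h1' h2']].
  have [-> ezz'] := thinR _ _ _ _ h1 h1'; split=> //.
  by move: h2'; rewrite -ezz'; apply: (good_fun (n := n.+2)) h2; left; exists g'.
- move=> x y x' y' [z [h1 h2]] [z' [h1' h2']].
  have [ezz' ->] := thinR' _ _ _ _ h2 h2'; split=> //.
  by move: h1'; rewrite -ezz'; apply: (good_cofun (n := n.+2)) h1; left; exists g.
have nowrap b l p : wrap n.+2 b l p.+1 <> p.
  by rewrite /wrap; case: ifP => [/andP[/eqP e _]|_]; lia.
have turn b b' : tgt n.+2 g b = src g' b -> tgt n.+2 g b' = src g' b' -> b = b'.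
  have [//|neq_b [_ e] [e' _]] := eqVneq b b'.
  have eb : b' = ~~ b by case: b b' neq_b {e e'} => [] [].
  by subst b'; case: (nowrap b (coord g b) (coord g (~~ b))); rewrite e e'.
move=> x y x' y' [z [[b [-> ez]] [c [ez' ->]]]] [z' [[b' [-> fz]] [c' [fz' ->]]]].
have ebc : b = c by have := etrans (esym ez) ez'; case.
have ebc' : b' = c' by have := etrans (esym fz) fz'; case.
subst c c'; by have -> : b = b' by apply: turn; rewrite -?ez -?fz.
Qed.

Definition grid_carrier (n : nat) : Type := {R : pt -> pt -> Prop | good n.+2 R}.

Definition grid_add n (R R' : grid_carrier n) : grid_carrier n :=
  exist _ _ (good_meet (proj2_sig R) (proj2_sig R')).

Definition grid_mul n (R R' : grid_carrier n) : grid_carrier n :=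
  exist _ _ (good_comp (proj2_sig R) (proj2_sig R')).

Definition grid (n : nat) : algebra22 := Algebra22 (@grid_add n) (@grid_mul n).

Lemma grid_inj n (R R' : grid n) :
  (forall x y, sval R x y <-> sval R' x y) -> R = R'.
Proof.
case: R R' => [R gR] [R' gR'] /= e.
have eR : R = R' by apply/funext => x; apply/funext => y; apply/propext.
by subst R'; congr exist; apply: Prop_irrelevance.
Qed.

(** * Admissible colourings that separate points *)

Definition admissible n (L : nat * nat -> Prop) (phi : pt -> bool) : Prop :=
  forall g, L g ->
    (forall b, phi (src g b) = phi (tgt n g b)) \/
    (forall b b', phi (src g b) = phi (src g b') /\
                  phi (tgt n g b) = phi (tgt n g b')).

Section Colourings.
Variables (n : nat) (L : nat * nat -> Prop).
Hypothesis L_gap : forall b l, exists2 c, c < n & ~ L (cell b l c).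

(* Cutting the line at a missing cell turns the cyclic order of its points into
   a linear one. *)
Lemma line_rank b l : exists2 r : nat -> nat, injective r &
  forall p, L (cell b l p) -> r (wrap n b l p.+1) = (r p).+1.
Proof.
rewrite /wrap; have [_|_] := eqVneq (b, l) (false, 0).
  by exists id => // p; rewrite andbF.
have [c lt_cn nLc] := L_gap b l.
(* Positions between the gap [c] and [n] keep their number, while [0] to [c] are moved behind
   [n - 1]; only the step out of [c] fails to raise the rank by one. *)
exists (fun p => if c < p < n then p else p + n).
  move=> p q; case: ifP => hp; case: ifP => hq; lia.
move=> p Lp; have neq_pc : p <> c by move=> e; rewrite e in Lp.
rewrite andbT; case: eqP => e; rewrite ?ltn0 /=; do 2?[case: ifP => ?]; lia.
Qed.

Lemma line_admissible (f : bool * nat -> bool) :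
  admissible n L (fun x => f x.1).
Proof. by move=> g _; left. Qed.

(** Both half-lines end at the sources of [g], so that [g] leaves the corner along both of its
    edges. *)
Definition corner (r : bool -> nat -> nat -> nat) (g : nat * nat) (x : pt) : bool :=
  let: (b, l, p) := x in (l == coord g b) && (r b l p <= r b l (coord g (~~ b))).

Lemma ranks : exists2 r : bool -> nat -> nat -> nat,
  forall b l, injective (r b l) &
  forall g b, L g -> r b (coord g b) (wrap n b (coord g b) (coord g (~~ b)).+1) =
                     (r b (coord g b) (coord g (~~ b))).+1.
Proof.
have /choice[f fP] : forall bl : bool * nat, exists r : nat -> nat,
    injective r /\ forall p, L (cell bl.1 bl.2 p) ->
      r (wrap n bl.1 bl.2 p.+1) = (r p).+1.
  by move=> bl; have [r r1 r2] := line_rank bl.1 bl.2; exists r.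
exists (fun b l => f (b, l)) => [b l|g b Lg]; first by have [] := fP (b, l).
by have [_ -> //] := fP (b, coord g b); rewrite cellK.
Qed.

Variable r : bool -> nat -> nat -> nat.
Hypothesis r_inj : forall b l, injective (r b l).
Hypothesis r_next : forall g b, L g ->
  r b (coord g b) (wrap n b (coord g b) (coord g (~~ b)).+1) =
  (r b (coord g b) (coord g (~~ b))).+1.

Lemma corner_src g b : corner r g (src g b).
Proof. by rewrite /corner /src eqxx leqnn. Qed.

Lemma corner_tgt g b : L g -> corner r g (tgt n g b) = false.
Proof. by move=> Lg; rewrite /corner /tgt r_next // ltnn andbF. Qed.

(** A step raises the rank by one, so it leaves the corner only from the rank of [g] itself, and
    injectivity of the rank then identifies the cell. *)
Lemma corner_other g g' b : L g' -> g' <> g ->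
  corner r g (tgt n g' b) = corner r g (src g' b).
Proof.
move=> Lg' neq_g; rewrite /corner /tgt /src; case: eqP => //= eb.
rewrite r_next // ltn_neqAle; case: eqP => //= /r_inj eN.
by case: neq_g; apply: coord_inj eN.
Qed.

Lemma corner_admissible g : admissible n L (corner r g).
Proof.
move=> g' Lg'; have [e|/eqP neq_g] := eqVneq g' g.
  by right=> b b'; rewrite -e !corner_src !corner_tgt.
by left=> b; rewrite corner_other.
Qed.

End Colourings.

(** Points on different lines are separated by colouring one line, points on the same line by the
    corner at the one of lower rank. *)
Lemma separate n L (L_gap : forall b l, exists2 c, c < n & ~ L (cell b l c))
    (x y : pt) : x <> y -> exists2 phi, admissible n L phi & phi x <> phi y.
Proof.
have [r r_inj r_next] := ranks L_gap.
move=> neq_xy; have [exy|neq_l] := eqVneq x.1 y.1; last first.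
  exists (fun z => z.1 == x.1); first exact: (@line_admissible n L (fun l => l == x.1)).
  by rewrite eqxx eq_sym (negPf neq_l).
case: x y exy neq_xy => [[b l] p] [[_ _] q] /= [<- <-] neq_xy.
wlog lt_pq : p q neq_xy / r b l p < r b l q => [hw|].
  case: (ltngtP (r b l p) (r b l q)) => [|lt_qp|/r_inj epq].
  - exact: hw.
  - case: (hw q p) => // [e|phi adm neq]; first by apply: neq_xy; rewrite e.
    by exists phi => // e; apply: neq.
  - by case: neq_xy; rewrite epq.
exists (corner r (cell b l p)); first exact: corner_admissible.
by rewrite /corner coord_cell coord_cellN eqxx leqnn leqNgt lt_pq.
Qed.

(** The colouring depends on [x]: if [x] is off both lines through [g], colour these lines; if it
    comes before [g], take the corner at [x]; if after, the corner at [g]. *)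
Lemma separate_letter n L
    (L_gap : forall b l, exists2 c, c < n & ~ L (cell b l c)) g (x : pt) :
  L g -> (forall b, x <> src g b) -> exists2 phi, admissible n L phi &
    forall b b', [/\ phi (src g b) = phi (src g b'),
                     phi (tgt n g b) = phi (tgt n g b') &
                     phi x <> phi (src g b)].
Proof.
have [r r_inj r_next] := ranks L_gap.
case: x => [[b l] p] Lg xNsrc.
have [el|neq_l] := eqVneq l (coord g b); last first.
  exists (fun z => z.1.2 == coord g z.1.1).
    exact: (@line_admissible n L (fun l => l.2 == coord g l.1)).
  by move=> c c'; rewrite /= !eqxx (negPf neq_l).
subst l; have neq_p : p <> coord g (~~ b) by move=> e; apply: (xNsrc b); rewrite /src -e.
case: (ltngtP (r b (coord g b) p) (r b (coord g b) (coord g (~~ b)))) =>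
    [lt_p|gt_p|/r_inj //].
  exists (corner r (cell b (coord g b) p)); first exact: corner_admissible.
  have neq_cell : g <> cell b (coord g b) p.
    by move=> e; apply: neq_p; rewrite e coord_cellN.
  (* On line [b] the source of [g] lies past the corner; its other source is on a line parallel to
     the other arm. *)
  have src0 c : corner r (cell b (coord g b) p) (src g c) = false.
    have [->|neq_c] := eqVneq c b.
      by rewrite /corner /src coord_cell coord_cellN leqNgt lt_p andbF.
    have -> : c = ~~ b by move: neq_c; clear; case: c; case: b.
    by rewrite /corner /src coord_cellN; case: eqP => // e; case: neq_p.
  move=> c c'; rewrite !(corner_other r_inj r_next _ Lg neq_cell) !src0; split=> //.
  by rewrite /corner coord_cell coord_cellN eqxx leqnn.
exists (corner r g); first exact: corner_admissible.
move=> c c'; rewrite !corner_src !(corner_tgt r_next _ Lg); split=> //.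
by rewrite /corner eqxx leqNgt gt_p.
Qed.

(** * Transfer of identities through colourings *)

Section Local.
Variables (n : nat) (v : nat -> grid n) (V : set nat).

Definition compatible (phi : pt -> bool) (psi : nat -> B21) : Prop :=
  forall m, V m -> forall x y, sval (v m) x y -> ent (psi m) (phi x) (phi y).

Lemma compatible_eval phi psi t x y : compatible phi psi ->
  (term_vars t `<=` V)%classic -> sval (eval v t) x y ->
  ent (eval (A := B21_semiring) psi t) (phi x) (phi y).
Proof.
move=> comp; elim: t x y => [m|t1 IH1 t2 IH2|t1 IH1 t2 IH2] x y /=.
- by move=> mV; apply: comp; apply: mV.
- rewrite subUset => -[V1 V2] [h1 h2].
  by rewrite ent_add IH1 //= IH2.
- rewrite subUset => -[V1 V2] [z [h1 h2]].
  by apply/ent_mul; exists (phi z); split; [apply: IH1|apply: IH2].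
Qed.

Hypothesis sep : forall x y, x <> y ->
  exists phi psi, compatible phi psi /\ phi x <> phi y.
Hypothesis undef : forall m x, V m -> (forall y, ~ sval (v m) x y) ->
  exists phi psi, compatible phi psi /\ forall b, ~ ent (psi m) (phi x) b.

(** Following [x] through the term leads to a variable undefined at the current point, or to a sum
    whose summands reach different points; [undef] or [sep] then gives a single colouring that makes
    the value in $B_2^1$ undefined as well. *)
Lemma undef_eval t x : (term_vars t `<=` V)%classic ->
  (forall y, ~ sval (eval v t) x y) ->
  exists phi psi, compatible phi psi /\
    forall b, ~ ent (eval (A := B21_semiring) psi t) (phi x) b.
Proof.
elim: t x => [m|t1 IH1 t2 IH2|t1 IH1 t2 IH2] x /=.
- by move=> mV; apply: undef; apply: mV.
- rewrite subUset => -[V1 V2] hN.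
  have [[y1 h1]|/forallNP/(IH1 _ V1)] := pselect (exists y, sval (eval v t1) x y);
    last first.
    move=> [phi [psi [comp h]]]; exists phi, psi; split=> // b.
    by rewrite ent_add => /andP[/h].
  have [[y2 h2]|/forallNP/(IH2 _ V2)] := pselect (exists y, sval (eval v t2) x y);
    last first.
    move=> [phi [psi [comp h]]]; exists phi, psi; split=> // b.
    by rewrite ent_add => /andP[_ /h].
  have /sep[phi [psi [comp neq]]] : y1 <> y2.
    by move=> e; apply: (hN y1); split=> //; rewrite e.
  exists phi, psi; split=> // b; rewrite ent_add => /andP[k1 k2]; apply: neq.
  rewrite (ent_fun (compatible_eval comp V1 h1) k1).
  by rewrite (ent_fun (compatible_eval comp V2 h2) k2).
- rewrite subUset => -[V1 V2] hN.
  have [[y h1]|/forallNP/(IH1 _ V1)] := pselect (exists y, sval (eval v t1) x y);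
    last first.
    move=> [phi [psi [comp h]]]; exists phi, psi; split=> // b.
    by move=> /ent_mul[c [/h]].
  have /(IH2 _ V2)[phi [psi [comp h]]] : forall z, ~ sval (eval v t2) y z.
    by move=> z h2; apply: (hN z); exists y.
  exists phi, psi; split=> // b /ent_mul[c [k1 k2]]; apply: (h b).
  by rewrite (ent_fun (compatible_eval comp V1 h1) k1).
Qed.

(** Where one side sends [x] to [y], the other must be defined, or [undef_eval] refutes the identity
    in $B_2^1$; if its image differed from [y], a colouring separating the two would refute it. *)
Lemma local_holds t t' : (term_vars t `<=` V)%classic ->
  (term_vars t' `<=` V)%classic ->
  holds B21_semiring (t, t') -> eval v t = eval v t'.
Proof.
have half u w x y : (term_vars u `<=` V)%classic -> (term_vars w `<=` V)%classic ->
    holds B21_semiring (u, w) -> sval (eval v u) x y -> sval (eval v w) x y.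
  move=> Vu Vw uw hu; have [[z hw]|/forallNP nw] :=
    pselect (exists z, sval (eval v w) x z).
    have [<- //|/sep[phi [psi [comp neq]]]] := pselect (z = y).
    case: neq; apply: ent_fun (compatible_eval comp Vw hw) _.
    by have /= <- := uw psi; apply: compatible_eval.
  have [phi [psi [comp h]]] := undef_eval Vw nw.
  by case: (h (phi y)); have /= <- := uw psi; apply: compatible_eval.
move=> Vt Vt' tt'; apply: grid_inj => x y; split; apply: half => //.
Qed.

End Local.

(** * Valuations in fewer variables than the side length *)

Section Valuation.
Variables (n : nat) (v : nat -> grid n) (s : seq nat).
Hypothesis lt_sn : size s < n.+2.

Definition present (g : nat * nat) : Prop :=
  exists2 m, m \in s & sval (v m) = letter n.+2 g.

(** Pigeonhole: a line with all letters present would need [n.+2] distinct variables. *)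
Lemma present_gap b l : exists2 c, c < n.+2 & ~ present (cell b l c).
Proof.
apply: contrapT => hN.
have /choice[f fP] : forall c : 'I_n.+2, exists m,
    m \in s /\ sval (v m) = letter n.+2 (cell b l c).
  move=> c; apply: contrapT => nex; apply: hN; exists c => // -[m ms e].
  by apply: nex; exists m.
have f_inj : injective f.
  move=> c c' e; have [_ ec] := fP c; have [_ ec'] := fP c'.
  move: ec; rewrite e ec' => /esym/letter_inj/(congr1 (coord^~ (~~ b))).
  by rewrite !coord_cellN => /val_inj.
have : size (codom f) <= size s.
  apply: uniq_leq_size; first exact/injectiveP.
  by move=> _ /codomP[c ->]; have [] := fP c.
by rewrite size_codom card_ord leqNgt lt_sn.
Qed.

Lemma admissible_elt phi m : admissible n.+2 present phi -> m \in s ->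
  exists b, forall x y, sval (v m) x y -> ent b (phi x) (phi y).
Proof.
move=> adm ms; have [[g e]|thinR] := proj2_sig (v m).
  have [|preserved|parallel] := adm g; first by exists m.
    exists bid => x y; rewrite e => -[b [-> ->]].
    by rewrite ent_id preserved.
  exists (bunit (phi (src g true)) (phi (tgt n.+2 g true))) => x y.
  rewrite e => -[b [-> ->]]; rewrite ent_unit.
  by have [-> ->] := parallel b true; rewrite !eqxx.
have [[x [y h]]|hN] := pselect (exists x y, sval (v m) x y).
  exists (bunit (phi x) (phi y)) => x' y' /(thinR _ _ _ _ h)[<- <-].
  by rewrite ent_unit !eqxx.
by exists bid => x y h; case: hN; exists x, y.
Qed.

Lemma admissible_compatible phi : admissible n.+2 present phi ->
  exists psi, compatible v [set` s] phi psi.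
Proof.
move=> adm.
have /choice[psi psiP] : forall m, exists b, m \in s ->
    forall x y, sval (v m) x y -> ent b (phi x) (phi y).
  move=> m; case: (boolP (m \in s)) => [ms|_]; last by exists bid.
  by have [b bP] := admissible_elt adm ms; exists b.
by exists psi => m ms; apply: psiP.
Qed.

Lemma admissible_undef phi m x b0 : admissible n.+2 present phi ->
  (forall y z, sval (v m) y z -> ent b0 (phi y) (phi z)) ->
  (forall b, ~ ent b0 (phi x) b) ->
  exists phi' psi, compatible v [set` s] phi' psi /\
    forall b, ~ ent (psi m) (phi' x) b.
Proof.
move=> adm h0 undef0; have [psi psiP] := admissible_compatible adm.
exists phi, (fun m' => if m' == m then b0 else psi m').
rewrite eqxx; split=> // m' m's y z.
by case: eqP => [->|_]; [apply: h0 | apply: psiP].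
Qed.

Lemma valuation_holds t t' : (term_vars t `<=` [set` s])%classic ->
  (term_vars t' `<=` [set` s])%classic ->
  holds B21_semiring (t, t') -> eval v t = eval v t'.
Proof.
apply: local_holds => [x y /(separate present_gap)[phi adm neq]|m x ms undef].
  by have [psi comp] := admissible_compatible adm; exists phi, psi.
have [[g e]|thinR] := proj2_sig (v m).
  have gP : present g by exists m.
  have xNsrc b : x <> src g b.
    by move=> ex; apply: (undef (tgt n.+2 g b)); rewrite e; exists b.
  (* [E] is defined at both colours, so the value of [m] has to be a matrix unit. *)
  have [phi adm parallel] := separate_letter present_gap gP xNsrc.
  apply: (admissible_undef (b0 := bunit (phi (src g true)) (phi (tgt n.+2 g true))))
      adm _ _ => [y z|b]; rewrite ?e ent_unit.
    by move=> [b [-> ->]]; have [-> -> _] := parallel b true; rewrite !eqxx.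
  by case: eqP => // ex; have [_ _] := parallel true true.
have [[y [z h]]|hN] := pselect (exists y z, sval (v m) y z).
  have /(separate present_gap)[phi adm neq] : x <> y.
    by move=> exy; apply: (undef z); rewrite exy.
  apply: (admissible_undef (b0 := bunit (phi y) (phi z))) adm _ _ => [y' z'|b].
    by move=> /(thinR _ _ _ _ h)[<- <-]; rewrite ent_unit !eqxx.
  by rewrite ent_unit; case: eqP.
apply: (admissible_undef (phi := fun=> true) (b0 := bzero)) => [g _|y z h|b].
- by left.
- by case: hN; exists y, z.
- by rewrite ent_zero.
Qed.

End Valuation.

(** * The parity identity and its validity in $B_2^1$ *)

Definition symbol : Type := ((nat * nat) + (bool * pt))%type.

(* Locked because simplification would otherwise try to compute the codes. *)
Definition code : symbol -> nat := locked pickle.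

Lemma codeK : pcancel code unpickle.
Proof. by rewrite /code -lock; apply: pickleK. Qed.

Definition xvar (g : nat * nat) : term := Var (code (inl g)).
Definition into (p : pt) : term := Var (code (inr (false, p))).
Definition back (p : pt) : term := Var (code (inr (true, p))).

(* [into p] and [back p] stand for the maps origin -> p and p -> origin.  If the
   value of [edge_term n g b] in B_2^1 has an entry (a, c), each point p gets as
   colour the state reached from a along [into p], and the letter g respects
   the colours of the two ends of its edge. *)
Definition edge_term (n : nat) (g : nat * nat) (b : bool) : term :=
  Add (Add (Mul (into (src g b)) (back (src g b)))
           (Mul (into (tgt n g b)) (back (tgt n g b))))
      (Mul (Mul (into (src g b)) (xvar g)) (back (tgt n g b))).

Definition add_terms (I : Type) (F : I -> term) (t0 : term) (r : seq I) : term :=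
  foldr (fun i => Add (F i)) t0 r.

Definition origin : pt := (false, 0, 0).

Definition grid_term (n : nat) : term :=
  add_terms (fun e : 'I_n * 'I_n * bool =>
               edge_term n (val e.1.1, val e.1.2) e.2)
    (Mul (into origin) (back origin)) (enum {: 'I_n * 'I_n * bool}).

(** The extra summand states that the two ends of the open row [0] have the same colour. *)
Definition parity_identity (n : nat) : identity :=
  (grid_term n, Add (grid_term n) (Mul (into origin) (back (false, 0, n)))).

Lemma ent_add_terms (psi : nat -> B21) (I : eqType) (F : I -> term) t0 r a b i :
  ent (eval (A := B21_semiring) psi (add_terms F t0 r)) a b -> i \in r ->
  ent (eval (A := B21_semiring) psi (F i)) a b.
Proof.
elim: r => // j r IH /=; rewrite ent_add inE => /andP[hj hr].
by case/orP => [/eqP->|]; last exact: IH.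
Qed.

Lemma grid_add_terms n (v : nat -> grid n) (I : Type) (F : I -> term) t0 r x y :
  sval (eval v t0) x y -> (forall i, sval (eval v (F i)) x y) ->
  sval (eval v (add_terms F t0 r)) x y.
Proof. by move=> h0 hF; elim: r => //= i r IH; split. Qed.

Lemma telescope_addb n (f : nat -> bool) :
  \big[addb/false]_(p < n) (f p (+) f p.+1) = f 0 (+) f n.
Proof.
elim: n => [|n IH]; first by rewrite big_ord0 addbb.
by rewrite big_ord_recr /= IH addbA addbK.
Qed.

(* Each letter changes the colour along its horizontal edge iff it does so along
   its vertical edge; summing over the grid, only the ends of row 0 survive. *)
Lemma grid_parity n (phi : pt -> bool) :
  (forall g b b', g.1 < n.+1 -> g.2 < n.+1 ->
     phi (src g b) (+) phi (tgt n.+1 g b) = phi (src g b') (+) phi (tgt n.+1 g b')) ->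
  phi origin = phi (false, 0, n.+1).
Proof.
(* Because of [wrap], position [n.+1] of a closed line counts as [0], so its differences telescope
   to [false]. *)
move=> par; pose f b l p := phi (b, l, wrap n.+1 b l p).
pose d b l p := f b l p (+) f b l p.+1.
have dE (i j : 'I_n.+1) : d false i j = d true j i.
  have := par (val i, val j) false true (ltn_ord i) (ltn_ord j).
  rewrite /d /f /wrap /src /tgt /= /wrap.
  by rewrite !(ltn_eqF (ltn_ord _)) /=.
have line b l : \big[addb/false]_(p < n.+1) d b l p = f b l 0 (+) f b l n.+1.
  exact: (telescope_addb n.+1 (f b l)).
have closed b l : (b, l) != (false, 0) -> f b l 0 (+) f b l n.+1 = false.
  by move=> bl; rewrite /f /wrap eqxx bl /= addbb.
have : \big[addb/false]_(i < n.+1) \big[addb/false]_(j < n.+1) d false i j = false.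
  (* Summed along columns, the total vanishes because every column is closed. *)
  under eq_bigr do under eq_bigr do rewrite dE.
  rewrite exchange_big /= big1 // => j _.
  by rewrite line closed.
rewrite big_ord_recl [X in _ (+) X]big1 => [|i _]; last by rewrite line closed.
rewrite line addbF /f /wrap /= eqxx /=.
by case: (phi _); case: (phi _).
Qed.

Lemma parity_identity_B21 n : holds B21_semiring (parity_identity n.+1).
Proof.
move=> psi; apply: ent_inj => a b; rewrite [RHS]ent_add.
case: (boolP (ent _ a b)) => // hu; apply/esym/ent_mul.
(* This is the state reached from [a], with [false] as default if there is none; [phiP] applies
   where a state exists. *)
pose phi s := ent (eval (A := B21_semiring) psi (into s)) a true.
have phiP s : ent (eval (A := B21_semiring) psi (Mul (into s) (back s))) a b ->
    ent (eval (A := B21_semiring) psi (into s)) a (phi s) /\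
    ent (eval (A := B21_semiring) psi (back s)) (phi s) b.
  move=> /ent_mul[c [h1 h2]]; suff <- : c = phi s by [].
  rewrite /phi; case: c h1 {h2} => [->|h1] //.
  by case E: (ent _ _ _) => //; apply: (ent_fun h1 E).
have edgeP g c : g.1 < n.+1 -> g.2 < n.+1 ->
    ent (eval (A := B21_semiring) psi (edge_term n.+1 g c)) a b.
  case: g => i j /= hi hj.
  by have := ent_add_terms (i := (Ordinal hi, Ordinal hj, c)) hu (mem_enum _ _).
have stepP g c : g.1 < n.+1 -> g.2 < n.+1 ->
    [/\ ent (eval (A := B21_semiring) psi (into (src g c))) a (phi (src g c)),
        ent (eval (A := B21_semiring) psi (back (tgt n.+1 g c))) (phi (tgt n.+1 g c)) b &
        ent (eval (A := B21_semiring) psi (xvar g)) (phi (src g c)) (phi (tgt n.+1 g c))].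
  move=> hi hj; have := edgeP g c hi hj; rewrite !ent_add -andbA.
  case/and3P => /phiP[h1 h2] /phiP[h3 h4] /ent_mul[k [/ent_mul[k' [h5 h6]] h7]].
  by move: h6; rewrite -(ent_fun h1 h5) (ent_cofun h7 h4).
(* The origin is the row source of the letter [(0, 0)], and the far end of row [0] is the row target
   of [(0, n)]. *)
exists (phi origin); split.
  by have [] := stepP (0, 0) false isT isT.
have -> : phi origin = phi (false, 0, n.+1).
  apply: grid_parity => g c c' hi hj.
  have [_ _ h] := stepP g c hi hj; have [_ _ h'] := stepP g c' hi hj.
  exact: ent_parity h h'.
have [_ h _] := stepP (0, n) false isT (ltnSn n).
have tgtE : tgt n.+1 (0, n) false = (false, 0, n.+1).
  by rewrite /tgt /wrap /= andbF.
by move: h; rewrite tgtE; apply.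
Qed.

(** * Failure in the grid and the conclusion *)

Lemma good_unit n p q : good n (fun x y => x = p /\ y = q).
Proof. by right=> x y x' y' [-> ->] [-> ->]. Qed.

Lemma good_letter n g : good n (letter n g).
Proof. by left; exists g. Qed.

(** Let each letter stand for itself: every summand of [grid_term] then loops at the origin, but the
    extra product is empty because the two ends of row [0] are distinct points. *)
Lemma parity_identity_grid n : ~ holds (grid n) (parity_identity n.+2).
Proof.
pose unit p q : grid n := exist _ _ (good_unit n.+2 p q).
pose lett g : grid n := exist _ _ (good_letter n.+2 g).
pose v m := match (unpickle m : option symbol) with
  | Some (inl g) => lett g
  | Some (inr (false, p)) => unit origin p
  | Some (inr (true, p)) => unit p origin
  | None => unit origin origin
  end.
have vx g : v (code (inl g)) = lett g by rewrite /v codeK.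
have vi p : v (code (inr (false, p))) = unit origin p by rewrite /v codeK.
have vb p : v (code (inr (true, p))) = unit p origin by rewrite /v codeK.
have hu : sval (eval v (grid_term n.+2)) origin origin.
  apply: grid_add_terms => [|[[i j] b]] /=; rewrite ?vi ?vb ?vx /=.
    by exists origin.
  set g := (val i, val j); split; first split.
  - by exists (src g b).
  - by exists (tgt n.+2 g b).
  - by exists (tgt n.+2 g b); split=> //; exists (src g b); split=> //; exists b.
move=> /(_ v) holds_v.
have {holds_v} : eval v (grid_term n.+2) = grid_add (eval v (grid_term n.+2))
    (grid_mul (v (code (inr (false, origin))))
              (v (code (inr (true, (false, 0, n.+2)))))) by exact: holds_v.
move: (eval v (grid_term n.+2)) hu => X; rewrite vi vb => hu e.
by move: hu; rewrite e => -[_ [z [[_ ->] []]]].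
Qed.

Lemma finite_term_vars t : finite_set (term_vars t).
Proof.
elim: t => [m|t1 IH1 t2 IH2|t1 IH1 t2 IH2] /=; first exact: finite_set1.
  by rewrite finite_setU.
by rewrite finite_setU.
Qed.

Lemma no_basis_finite_vars (Sigma : set identity) :
  is_basis B21_semiring Sigma -> ~ finite_set (identities_vars Sigma).
Proof.
move=> [Sigma_holds Sigma_complete] /finite_seqP[s sE].
(* The grid of side [(size s).+2] has lines longer than the number of variables of [Sigma]. *)
apply: (@parity_identity_grid (size s)).
apply: (Sigma_complete _ (parity_identity_B21 _)) => -[t t'] Stt' v.
have sub : (term_vars t `|` term_vars t' `<=` [set` s])%classic.
  by rewrite -sE => m hm; exists (t, t').
move: sub; rewrite subUset => -[Vt Vt'].
exact: (valuation_holds v (leqnSn _) Vt Vt' (Sigma_holds _ Stt')).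
Qed.

Theorem theorem3 :
  (~ exists Sigma : set identity,
       is_basis B21_semiring Sigma /\ finite_set (identities_vars Sigma)) /\
  (~ exists Sigma : set identity,
       is_basis B21_semiring Sigma /\ finite_set Sigma).
Proof.
split=> -[Sigma [basis fin]]; apply: (no_basis_finite_vars basis) => //.
by apply: bigcup_finite => // e _; rewrite finite_setU; split; apply: finite_term_vars.
Qed.
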